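(* Let $1\le r\le n$ and let $(\mathbf X^s,\mathbf U^s)$ be a stationary pair of stochastic processes. Assume that the stochastic optimal control problem has the $L^r$ turnpike property with respect to $(\mathbf X^s,\mathbf U^s)$. Then it also has the pathwise-in-probability turnpike property with respect to $(\mathbf X^s,\mathbf U^s)$.
   Context: Setting. $\mathcal X,\mathcal U,\mathcal W$ are separable Banach spaces, $\|\cdot\|$ is the norm of $\mathcal X$, $(\Omega,\mathcal F,\mathbb P)$ is a probability space, $n,l\ge 1$ are fixed exponents, and $L^n(\Omega,\mathcal F,\mathbb P;\mathcal X)$ is the space of $\mathcal X$-valued random variables with finite $n$-th moment. $f:\mathcal X\times\mathcal U\times\mathcal W\to\mathcal X$ is continuous in $(x,u)$ for almost all $w$. $\mathbf W=(W(0),W(1),\dots)$ is a fixed i.i.d. sequence with distribution $\varrho_W$. The control system is $X(k+1)=f(X(k),U(k),W(k))$, $X(0)=X_0$, with $X(k)\in L^n(\Omega,\mathcal F_k,\mathbb P;\mathcal X)$, $U(k)\in L^l(\Omega,\mathcal F_k,\mathbb P;\mathcal U)$, $\mathcal F_k=\sigma(X(0),\dots,X(k))$; it is always required that $W(k)$ is independent of $(X(k),U(k))$. The trajectory is denoted $X_{\mathbf U}(k,X_0)$ or $X(k)$. The constraint set $\mathbb Y\subseteq L^n(\Omega,\mathcal F,\mathbb P;\mathcal X)\times L^l(\Omega,\mathcal F,\mathbb P;\mathcal U)$ is law-invariant (if $(X,U)\in\mathbb Y$ and $(Y,V)$ has the same joint law as $(X,U)$, then $(Y,V)\in\mathbb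 Y$); $\mathbb X:=\{X : \exists U,\ (X,U)\in\mathbb Y\}$. $\mathbb U^N(X_0)$ is the set of admissible control sequences $\mathbf U=(U(0),\dots,U(N-1))$ for $X_0\in\mathbb X$: $U(k)\in L^l(\Omega,\mathcal F_k,\mathbb P;\mathcal U)$, $(X(k),U(k))\in\mathbb Y$ for $k=0,\dots,N-1$, and $X(N)\in\mathbb X$; $\mathbb U^\infty(X_0)$ is defined analogously for infinite sequences ($(X(k),U(k))\in\mathbb Y$ for all $k\in\mathbb N_0$). It is assumed that $\mathbb U^\infty(X_0)\ne\emptyset$ for all $X_0\in\mathbb X$. The stage cost $\ell:\mathbb Y\to\mathbb R$ is law-invariant ($\ell(X,U)$ depends only on the joint law of $(X,U)$). Markov policies. $\Pi_0(\mathcal X,\mathcal U)$ is the set of (measurable) maps $\pi:\mathcal X\to\mathcal U$ with $\pi\circ X\in L^l(\Omega,\mathcal F,\mathbb P;\mathcal U)$ for all $X\in L^n(\Omega,\mathcal F,\mathbb P;\mathcal X)$. $\mathbb F^N(X_0)$ (for $N\in\mathbb N\cup\{\infty\}$) is the set of $\mathbf U\in\mathbb U^N(X_0)$ such that for every $k<N$ there is $\pi_k\in\Pi_0(\mathcal X,\mathcal U)$ with $U(k)=\pi_k(X(k))$. The stochastic optimal control problem is to minimize $J_N(X_0,\mathbf U)=\sum_{k=0}^{N-1}\ell(X(k),U(k))$ over $\mathbf U\in\mathbb F^N(X_0)$. Stationary pair. $(\mathbf X^s,\mathbf U^s)$ with $X^s(k+1)=f(X^s(k),U^s(k),W(k))$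 (same noise $\mathbf W$), $\mathbf U^s\in\mathbb F^\infty(X^s(0))$, is stationary if the laws of $X^s(k)$, of $U^s(k)$ and of $(X^s(k),U^s(k))$ do not depend on $k\in\mathbb N_0$. Then $\ell(\mathbf X^s,\mathbf U^s)$ denotes the $k$-independent value $\ell(X^s(k),U^s(k))$. $\mathcal K_\infty$ is the set of continuous, strictly increasing, unbounded $\alpha:[0,\infty)\to[0,\infty)$ with $\alpha(0)=0$. $L^r$ turnpike property: there exists $\alpha_1\in\mathcal K_\infty$ such that for each $X_0\in\mathbb X$ there is $C_a>0$ such that for each $\delta>0$, $N\in\mathbb N$, each $\mathbf U\in\mathbb F^N(X_0)$ with $J_N(X_0,\mathbf U)\le\delta+N\ell(\mathbf X^s,\mathbf U^s)$ and each $\varepsilon>0$, $$\#\{k\in\{0,\dots,N\} : \mathbb E[\|X_{\mathbf U}(k,X_0)-X^s(k)\|^r]\le\varepsilon\}\ \ge\ N-\frac{\delta+C_a}{\alpha_1(\varepsilon)}.$$ Pathwise-in-probability turnpike property: there exists $\alpha_2\in\mathcal K_\infty$ such that for each $X_0\in\mathbb X$ there is $C_b>0$ such that for each $\delta>0$, $N\in\mathbb N$, each $\mathbf U\in\mathbb F^N(X_0)$ with $J_N(X_0,\mathbf U)\le\delta+N\ell(\mathbf X^s,\mathbf U^s)$ and each $\varepsilon>0$, $$\#\{k\in\{0,\dots,N\} : \mathbb P(\|X_{\mathbf U}(k,X_0)-X^s(k)\|\le\varepsilon)\ge 1-\varepsilon\}\ \ge\ N-\frac{\delta+C_b}{\alpha_2(\varepsilon)}.$$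 *)

(* Defs.v *)
From HB Require Import structures.
From mathcomp Require Import all_boot all_order all_algebra.
From mathcomp Require Import all_classical all_reals all_analysis.

Set Implicit Arguments.
Unset Strict Implicit.
Unset Printing Implicit Defensive.

Import Order.TTheory GRing.Theory Num.Theory.
Import numFieldNormedType.Exports.

Local Open Scope classical_set_scope.
Local Open Scope ring_scope.

(* T itself, carrying its Borel sigma-algebra as measurable structure. *)
Notation borel T := (g_sigma_algebraType (@open T)).

Definition separable (T : topologicalType) : Prop :=
  exists2 D : set T, countable D & dense D.

Section probability_notions.
Context {d : measure_display} {Omega : measurableType d} {R : realType}.
Variable P : probability Omega R.

Definition sigma_of {d'} {T : measurableType d'} (X : Omega -> T) :
    set (set Omega) :=
  preimage_set_system setT X measurable.

(* sigma(X(0), ..., X(k)) *)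
Definition sigma_upto {d'} {T : measurableType d'} (X : nat -> Omega -> T)
    (k : nat) : set (set Omega) :=
  <<s \bigcup_(j in `I_k.+1) sigma_of (X j) >>.

(* sigma(X(0), X(1), ...) *)
Definition sigma_seq {d'} {T : measurableType d'} (X : nat -> Omega -> T) :
    set (set Omega) :=
  <<s \bigcup_j sigma_of (X j) >>.

Definition indep_sigma (G H : set (set Omega)) : Prop :=
  forall A B, G A -> H B -> P (A `&` B) = (P A * P B)%E.

Definition mutually_indep {d'} {T : measurableType d'}
    (X : nat -> Omega -> T) : Prop :=
  forall (J : seq nat) (B : nat -> set T), uniq J ->
    (forall j, measurable (B j)) ->
    P (\bigcap_(j in [set` J]) (X j @^-1` B j)) =
    (\prod_(j <- J) P (X j @^-1` B j))%E.

(* The equality is restricted to measurable sets because the library's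
   [pushforward] is a function on all sets. *)
Definition same_law {d'} {T : measurableType d'} (X Y : Omega -> T) : Prop :=
  forall B, measurable B -> pushforward P X B = pushforward P Y B.

Definition iid {d'} {T : measurableType d'} (X : nat -> Omega -> T)
    (rho : probability T R) : Prop :=
  [/\ forall k, measurable_fun setT (X k),
      forall k B, measurable B -> pushforward P (X k) B = rho B &
      mutually_indep X].

(* L^p(Omega, G, P; V) for a sub-sigma-algebra G, as a set of functions:
   no quotient by almost sure equality is taken. *)
Definition Lp {V : normedModType R} (p : R) (G : set (set Omega)) :
    set (Omega -> V) :=
  [set X : Omega -> V | sigma_of (X : Omega -> borel V) `<=` G /\
     (\int[P]_w (`|X w| `^ p)%:E < +oo)%E].

Definition pairing {S T : Type} (X : Omega -> S) (Y : Omega -> T) :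
    Omega -> S * T :=
  fun w => (X w, Y w).

End probability_notions.

(* Only the values of a on [0, +oo[ matter. *)
Definition class_Kinfty {R : realType} (a : R -> R) : Prop :=
  [/\ {within `[0, +oo[, continuous a},
      a 0 = 0,
      {in `[0, +oo[ &, {homo a : x y / x < y}} &
      forall M, exists2 x, 0 <= x & M < a x].

Record ocp {d : measure_display} {Omega : measurableType d} {R : realType}
    (P : probability Omega R) (X U W : completeNormedModType R) := Ocp {
  dyn : X -> U -> W -> X;
  noise : nat -> Omega -> W;
  noise_law : probability (borel W) R;
  expX : R;
  expU : R;
  constr : set ((Omega -> X) * (Omega -> U));
  stage_cost : (Omega -> X) -> (Omega -> U) -> R (* used only on [constr] *)
}.

Section control_problem.
Context {d : measure_display} {Omega : measurableType d} {R : realType}.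
Context {P : probability Omega R} {X U W : completeNormedModType R}.
Variable S : ocp P X U W.

Local Notation law_pair Y V := (pairing Y V : Omega -> borel X * borel U).

Definition constrX : set (Omega -> X) :=
  [set Y | exists V, constr S (Y, V)].

(* X_U(k, X0); control sequences of length N are sequences on nat of which
   only the entries k < N are used. *)
Fixpoint traj (V : nat -> Omega -> U) (X0 : Omega -> X) (k : nat) :
    Omega -> X :=
  if k is j.+1 then fun w => dyn S (traj V X0 j w) (V j w) (noise S j w)
  else X0.

(* The requirements on (X(k), U(k)) at time k: those of the control system,
   including the independence of W(k), and the constraint. *)
Definition admissible_at (X0 : Omega -> X) (V : nat -> Omega -> U) (k : nat) :
    Prop :=
  let Y := traj V X0 in
  let Fk := sigma_upto (Y : nat -> Omega -> borel X) k in
  [/\ Lp P (expX S) Fk (Y k),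
      Lp P (expU S) Fk (V k),
      indep_sigma P (sigma_of (noise S k : Omega -> borel W))
                    (sigma_of (law_pair (Y k) (V k))) &
      constr S (Y k, V k)].

Definition admissible (N : nat) (X0 : Omega -> X) :
    set (nat -> Omega -> U) :=
  [set V | (forall k, (k < N)%N -> admissible_at X0 V k) /\
           constrX (traj V X0 N)].

Definition admissible_infty (X0 : Omega -> X) : set (nat -> Omega -> U) :=
  [set V | forall k, admissible_at X0 V k].

Definition policy : set (X -> U) :=
  [set p | measurable_fun [set: borel X] (p : borel X -> borel U) /\
    forall Y : Omega -> X, Lp P (expX S) measurable Y ->
      Lp P (expU S) measurable (p \o Y)].

Definition markov_at (X0 : Omega -> X) (V : nat -> Omega -> U) (k : nat) :
    Prop :=
  exists2 p, policy p & {ae P, forall w, V k w = p (traj V X0 k w)}.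

Definition markov (N : nat) (X0 : Omega -> X) : set (nat -> Omega -> U) :=
  [set V | admissible N X0 V /\ forall k, (k < N)%N -> markov_at X0 V k].

Definition markov_infty (X0 : Omega -> X) : set (nat -> Omega -> U) :=
  [set V | admissible_infty X0 V /\ forall k, markov_at X0 V k].

Definition cost (N : nat) (X0 : Omega -> X) (V : nat -> Omega -> U) : R :=
  \sum_(k < N) stage_cost S (traj V X0 k) (V k).

(* In [nonempty_admissible] the initial value is independent of the noise
   sequence: a law-invariant [constr] also contains initial values depending
   on W(0), for which no control meets the independence requirement. *)
Record standing_assumptions : Prop := StandingAssumptions {
  separableX : separable X;
  separableU : separable U;
  separableW : separable W;
  expX_ge1 : 1 <= expX S;
  expU_ge1 : 1 <= expU S;
  dyn_continuous : {ae noise_law S, forall w,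
    continuous (fun xu : X * U => dyn S xu.1 xu.2 w)};
  noise_iid : iid P (noise S : nat -> Omega -> borel W) (noise_law S);
  constr_Lp : forall Y V, constr S (Y, V) ->
    Lp P (expX S) measurable Y /\ Lp P (expU S) measurable V;
  constr_law_invariant : forall Y V Y' V', constr S (Y, V) ->
    measurable_fun setT (Y' : Omega -> borel X) ->
    measurable_fun setT (V' : Omega -> borel U) ->
    same_law P (law_pair Y' V') (law_pair Y V) -> constr S (Y', V');
  stage_cost_law_invariant : forall Y V Y' V',
    constr S (Y, V) -> constr S (Y', V') ->
    same_law P (law_pair Y V) (law_pair Y' V') ->
    stage_cost S Y V = stage_cost S Y' V';
  nonempty_admissible : forall X0, constrX X0 ->
    indep_sigma P (sigma_of (X0 : Omega -> borel X))
                  (sigma_seq (noise S : nat -> Omega -> borel W)) ->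
    admissible_infty X0 !=set0
}.

Section stationary_pair.
Variables (Xs : nat -> Omega -> X) (Us : nat -> Omega -> U).

Definition stationary_pair : Prop :=
  [/\ forall k, Lp P (expX S) measurable (Xs k),
      forall k,
        {ae P, forall w, Xs k.+1 w = dyn S (Xs k w) (Us k w) (noise S k w)},
      markov_infty (Xs 0%N) Us &
      forall j k,
      [/\ same_law P (Xs j : Omega -> borel X) (Xs k),
          same_law P (Us j : Omega -> borel U) (Us k) &
          same_law P (law_pair (Xs j) (Us j)) (law_pair (Xs k) (Us k))]].

(* The value at time 0; for a stationary pair it is the one at every time. *)
Definition stationary_cost : R := stage_cost S (Xs 0%N) (Us 0%N).

Definition near_optimal (N : nat) (X0 : Omega -> X) (delta : R) :
    set (nat -> Omega -> U) :=
  [set V | markov N X0 V /\ cost N X0 V <= delta + N%:R * stationary_cost].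

Definition Lr_turnpike (r : R) : Prop :=
  exists2 a1 : R -> R, class_Kinfty a1 &
  forall X0, constrX X0 -> exists2 Ca : R, 0 < Ca &
  forall (delta : R) (N : nat) V (eps : R), 0 < delta -> (0 < N)%N ->
    near_optimal N X0 delta V -> 0 < eps ->
    N%:R - (delta + Ca) / a1 eps <=
    #|[pred k : 'I_N.+1 |
        `[< ('E_P[fun w => (`|traj V X0 k w - Xs k w| `^ r)%R] <= eps%:E)%E >]]|%:R.

Definition pathwise_turnpike : Prop :=
  exists2 a2 : R -> R, class_Kinfty a2 &
  forall X0, constrX X0 -> exists2 Cb : R, 0 < Cb &
  forall (delta : R) (N : nat) V (eps : R), 0 < delta -> (0 < N)%N ->
    near_optimal N X0 delta V -> 0 < eps ->
    N%:R - (delta + Cb) / a2 eps <=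
    #|[pred k : 'I_N.+1 |
        `[< (P [set w | (`|traj V X0 k w - Xs k w| <= eps)%R] >=
             (1 - eps)%:E)%E >]]|%:R.

End stationary_pair.
End control_problem.

(* Main.v *)
Require Import Defs.
From HB Require Import structures.
From mathcomp Require Import all_boot all_order all_algebra.
From mathcomp Require Import all_classical all_reals all_analysis.
From mathcomp Require Import measurable_realfun lra.

Set Implicit Arguments.
Unset Strict Implicit.
Unset Printing Implicit Defensive.

Import Order.TTheory GRing.Theory Num.Theory.
Import numFieldNormedType.Exports.

Local Open Scope classical_set_scope.
Local Open Scope ring_scope.

(** The comparison function of the conclusion is [fun x => a1 (x `^ (r + 1))],
    where [a1] is that of the [L^r] property, and the constants [Ca] are kept.
    Markov's inequality shows that a time [k] at which the [r]-th moment of the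
    distance to the stationary process is at most [eps `^ (r + 1)] is one at
    which that distance exceeds [eps] with probability at most [eps]
    ([moment_le_probability_ge]). So the [L^r] property at level
    [eps `^ (r + 1)] bounds the number of good times from below, and the new
    comparison function is still of class K-infinity ([class_Kinfty_powR]).

    Markov's inequality requires the distance of the two processes to be a
    random variable. This is where separability of the state space enters
    ([measurable_fun_dist]). *)

Lemma sigma_of_measurable_fun (d d' : measure_display) (Omega : measurableType d)
    (T : measurableType d') (Y : Omega -> T) :
  sigma_of Y `<=` measurable -> measurable_fun setT Y.
Proof. by move=> mY _ B mB; apply: mY; exists B. Qed.

Lemma measurable_fun_dist_cst (R : realType) (d : measure_display)
    (Omega : measurableType d) (V : normedModType R) (Y : Omega -> V) (q : V) :
  measurable_fun setT (Y : Omega -> borel V) ->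
  measurable_fun setT (fun w => `|Y w - q|).
Proof.
move=> mY; apply: (measurability _ (RGenInftyO.measurableE R)).
move=> _ [_ [a ->] <-]; rewrite preimage_itvNyo.
apply: (mY measurableT ((fun v : V => `|v - q|) @^-1` `]-oo, a[)).
apply: sub_sigma_algebra.
have /continuousP : continuous (fun v : V => `|v - q|).
  by move=> v; apply: cvg_norm; apply: cvgB; [exact: cvg_id|exact: cvg_cst].
by apply; exact: interval_open.
Qed.

(** The joint law of [Y] and [Z] lives on the product of the two Borel
    sigma-algebras, for which the norm of the difference is not measurable on a
    general Banach space. With [D] countable and dense, [`|y - z|] is the infimum
    over [q] in [D] of [`|y - q| + `|z - q|], which expresses its sublevel sets
    as countable unions of measurable sets. *)
Lemma measurable_fun_dist (R : realType) (d : measure_display)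
    (Omega : measurableType d) (V : normedModType R) (Y Z : Omega -> V) :
  separable V ->
  measurable_fun setT (Y : Omega -> borel V) ->
  measurable_fun setT (Z : Omega -> borel V) ->
  measurable_fun setT (fun w => `|Y w - Z w|).
Proof.
move=> [D cD dD] mY mZ; apply: (measurability _ (RGenInftyO.measurableE R)).
move=> _ [_ [a ->] <-]; rewrite preimage_itvNyo setTI.
have -> : [set w | (`|Y w - Z w| < a)%R] =
    \bigcup_(q in D) [set w | `|Y w - q| + `|Z w - q| < a].
  apply/seteqP; split=> w /=.
  - move=> lta; have gap : 0 < (a - `|Y w - Z w|) / 2.
      by rewrite divr_gt0// subr_gt0.
    (* [q] is chosen close to [Z w]: the triangle inequality through
       [q] then loses at most twice their distance. *)
    have [q [Zq Dq]] : (ball (Z w) ((a - `|Y w - Z w|) / 2) `&` D) !=set0.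
      by apply: dD; [exists (Z w); exact: ballxx|exact: ball_open].
    exists q => //=; move: Zq; rewrite -ball_normE/= => Zq.
    have Yq : `|Y w - q| <= `|Y w - Z w| + `|Z w - q|.
      exact: ler_distD.
    move: gap Zq Yq; move: `|Y w - q| `|Z w - q| `|Y w - Z w| lta => *; lra.
  - move=> [q _ /=]; apply: le_lt_trans.
    by rewrite (distrC (Z w)) ler_distD.
rewrite bigcup_set_type; apply: countable_bigcupT_measurable.
  by have := cD; rewrite (eq_countable (card_setT D)).
move=> q; rewrite -[X in measurable X]setTI -preimage_itvNyo.
have mYZ := measurable_funD (measurable_fun_dist_cst (val q) mY)
                            (measurable_fun_dist_cst (val q) mZ).
by apply: mYZ => //; exact: measurable_itv.
Qed.

Lemma probability_gt_powR (R : realType) (d : measure_display)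
    (Omega : measurableType d) (P : probability Omega R) (Z : Omega -> R)
    (r eps : R) :
  measurable_fun setT Z -> (forall w, 0 <= Z w) -> 0 < r -> 0 < eps ->
  ((eps `^ r)%:E * P [set w | (eps < Z w)%R] <= 'E_P[fun w => (Z w `^ r)%R])%E.
Proof.
move=> mZ Z0 r0 e0.
have := @markov _ _ _ P (mfun_Sub (mem_set mZ)) (fun x => x `^ r) eps e0
  (@measurable_powR R r) (fun x _ => powR_ge0 x r) (ge0_ler_powR (ltW r0)).
rewrite (_ : _ \o _ = (fun w => Z w `^ r)); last first.
  by apply/funext => w /=; rewrite ger0_norm.
apply: le_trans; apply: lee_wpmul2l; first by rewrite lee_fin powR_ge0.
have mitv (i : interval R) : measurable (Z @^-1` [set` i]).
  by rewrite -[X in measurable X]setTI; apply: mZ => //; exact: measurable_itv.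
apply: le_measure; rewrite ?inE.
- by rewrite -preimage_itvoy; exact: mitv.
- rewrite [X in measurable X](_ : _ = Z @^-1` `[eps, +oo[); first exact: mitv.
  rewrite preimage_itvcy; apply/funext => w /=.
  by rewrite lee_fin ger0_norm.
- by move=> w /= ltZ; rewrite lee_fin ger0_norm// ltW.
Qed.

(** By Markov's inequality the probability of [eps < Z] is at most
    [eps `^ (r + 1) / eps `^ r = eps]. *)
Lemma moment_le_probability_ge (R : realType) (d : measure_display)
    (Omega : measurableType d) (P : probability Omega R) (Z : Omega -> R)
    (r eps : R) :
  measurable_fun setT Z -> (forall w, 0 <= Z w) -> 0 < r -> 0 < eps ->
  ('E_P[fun w => (Z w `^ r)%R] <= (eps `^ (r + 1))%:E)%E ->
  ((1 - eps)%:E <= P [set w | (Z w <= eps)%R])%E.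
Proof.
move=> mZ Z0 r0 e0 /(le_trans (probability_gt_powR P mZ Z0 r0 e0)).
have mle : measurable [set w | (Z w <= eps)%R].
  rewrite -[X in measurable X]setTI -preimage_itvNyc.
  by apply: mZ => //; exact: measurable_itv.
have -> : [set w | (eps < Z w)%R] = ~` [set w | (Z w <= eps)%R].
  by apply/seteqP; split=> w /=; rewrite real_ltNge ?num_real// => /negP.
rewrite probability_setC// -(fineK (fin_num_measure P _ mle)).
rewrite -EFinB -EFinM !lee_fin powRD ?powRr1 ?(ltW e0)//; last first.
  by rewrite (gt_eqF e0) implybT.
by rewrite ler_pM2l ?powR_gt0// lerBlDr addrC -lerBlDr.
Qed.

(** Continuity at [0] is only one-sided, so it is checked separately: [x `^ p]
    tends to [0] from the right when [x] does. *)
Lemma class_Kinfty_powR (R : realType) (a : R -> R) (p : R) :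
  0 < p -> class_Kinfty a -> class_Kinfty (fun x => a (x `^ p)).
Proof.
move=> p0 [/continuous_within_itvcyP [ca ca0] a0 amono aunb]; split.
- apply/continuous_within_itvcyP; split.
  + move=> x; rewrite in_itv/= andbT => x0.
    apply: (@continuous_comp _ _ _ (fun y : R => y `^ p) a).
      apply/differentiable_continuous/derivable1_diffP.
      by have [] := is_derive1_powR p x0.
    by apply: ca; rewrite in_itv/= andbT powR_gt0.
  + rewrite powR0 ?gt_eqF//; apply: (cvg_comp _ _ _ ca0).
    move=> A A0; have near0A := powR_cvg0 p0 A0.
    suff : \forall x \near (0 : R)^'+, A (x `^ p) by [].
    near=> x.
    have : 0 < x `^ p by rewrite powR_gt0.
    by near: x; exact: near0A.
- by rewrite powR0 ?gt_eqF.
- move=> x y; rewrite !in_itv/= !andbT => x0 y0 xy.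
  by apply: amono; rewrite ?in_itv/= ?andbT ?powR_ge0 ?gt0_ltr_powR.
- move=> M; have [x x0 Mx] := aunb M; exists (x `^ p^-1).
    exact: powR_ge0.
  by rewrite -powRrM mulVf ?gt_eqF// powRr1.
Unshelve. all: by end_near. Qed.

(** The final state is covered by the terminal condition of admissibility, which
    only asks for membership in the projection [constrX] of the constraint set;
    since [constr] consists of pairs of integrable random vectors, this suffices. *)
Lemma admissible_traj_measurable (R : realType) (d : measure_display)
    (Omega : measurableType d) (P : probability Omega R)
    (X U W : completeNormedModType R) (S : ocp P X U W)
    (hS : standing_assumptions S) (N : nat) (X0 : Omega -> X)
    (V : nat -> Omega -> U) (k : nat) :
  admissible S N X0 V -> (k <= N)%N ->
  measurable_fun setT (traj S V X0 k : Omega -> borel X).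
Proof.
move=> [adm [V' endN]]; rewrite leq_eqVlt => /predU1P[->|ltkN].
  by have [[/sigma_of_measurable_fun]] := constr_Lp hS endN.
have [_ _ _ /(constr_Lp hS)[[/sigma_of_measurable_fun//]]] := adm k ltkN.
Qed.

Theorem mainTheorem2 (R : realType) (d : measure_display)
    (Omega : measurableType d) (P : probability Omega R)
    (X U W : completeNormedModType R) (S : ocp P X U W)
    (hS : standing_assumptions S)
    (r : R) (hr1 : 1 <= r) (hrn : r <= expX S)
    (Xs : nat -> Omega -> X) (Us : nat -> Omega -> U)
    (hs : stationary_pair S Xs Us)
    (hLr : Lr_turnpike S Xs Us r) :
  pathwise_turnpike S Xs Us.
Proof.
case: hLr => a1 Ka1 Hr; have r0 : 0 < r by exact: lt_le_trans hr1.
exists (fun x => a1 (x `^ (r + 1))).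
  by apply: class_Kinfty_powR => //; rewrite addr_gt0.
move=> X0 /Hr[Ca Ca0 HCa]; exists Ca => // delta N V eps delta0 N0 opt eps0.
have eps'0 : 0 < eps `^ (r + 1) by exact: powR_gt0.
apply: le_trans (HCa _ _ _ _ delta0 N0 opt eps'0) _.
rewrite ler_nat; apply: subset_leq_card; apply/fintype.subsetP => k.
move=> /asboolP Ek; apply/asboolP.
case: opt => [[adm _] _]; case: hs => LXs _ _ _.
have kN : (k <= N)%N by rewrite -ltnS.
have [mXs _] := LXs k.
apply: moment_le_probability_ge r0 eps0 Ek => //.
apply: measurable_fun_dist (separableX hS) _ _.
  exact: (admissible_traj_measurable hS adm kN).
exact: sigma_of_measurable_fun.
Qed.
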